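(* Let $p$ be an odd prime, and let the dihedral group $G=D_{2p}$ of order $2p$ act on $F[V]=F[x_1,\ldots,x_r,y_1,\ldots,y_r,z_1,\ldots,z_s,w_1,\ldots,w_s]$, with $F$ of characteristic two, as described in the context. Then the top degree of the coinvariants $F[V]_G$ equals $s+\max(r,p)$ if $r\ge 1$, and equals $s$ if $r=0$.
   Context: Let $p$ be an odd prime and let $G=D_{2p}$ be the dihedral group of order $2p$, generated by an element $\sigma$ of order $2$ and an element $\rho$ of order $p$. Let $F$ be a field of characteristic two containing a primitive $p$th root of unity. $G$ acts by graded $F$-algebra automorphisms on the polynomial ring $F[V]=F[x_1,\ldots,x_r,y_1,\ldots,y_r,z_1,\ldots,z_s,w_1,\ldots,w_s]$ (with $r,s\ge 0$) as follows: $\sigma$ interchanges $x_i$ and $y_i$ for $i=1,\ldots,r$ and interchanges $z_i$ and $w_i$ for $i=1,\ldots,s$; $\rho$ fixes all $z_i$ and $w_i$, while $\rho(x_i)=\lambda_i x_i$ and $\rho(y_i)=\lambda_i^{-1}y_i$, where $\lambda_i\in F$ is a nontrivial $p$-th root of unity ($\lambda_i^p=1$, $\lambda_i\ne 1$) for $i=1,\ldots,r$. The Hilbert ideal $I_H$ is the ideal of $F[V]$ generated by all $G$-invariant polynomials of positive degree, the coinvariant ring is $F[V]_G=F[V]/I_H$ (graded by degree), and its top degree is the largest degree in which it is nonzero. *)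

(* Defs.v *)
From HB Require Import structures.
From mathcomp Require Import all_boot all_order all_algebra all_fingroup.
From mathcomp Require Import extremal.
From mathcomp Require Import boolp.
From mathcomp.multinomials Require Import mpoly.

Set Implicit Arguments.
Unset Strict Implicit.
Unset Printing Implicit Defensive.

Import GRing.Theory.
Local Open Scope ring_scope.
Local Open Scope quotient_scope.

Definition ideal_gen (R : comNzRingType) (S : R -> Prop) (f : R) : Prop :=
  exists (m : nat) (h g : 'I_m -> R),
    (forall j, S (g j)) /\ f = \sum_(j < m) h j * g j.

Section GradedActions.

Variables (F : fieldType) (n : nat) (gT : finGroupType) (G : {group gT}).
Variable to : action G {mpoly F[n]}.

Record graded_alg_action : Prop := GradedAlgAction {
  gaa_linear : forall g, g \in G -> linear (to^~ g);
  gaa_monoid_morphism : forall g, g \in G -> monoid_morphism (to^~ g);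
  gaa_homog : forall g d f,
    g \in G -> f \is d.-homog -> to f g \is d.-homog
}.

(* Homogeneity matters: the inhomogeneous invariants of positive degree
   (such as 1 + f, f invariant) would generate the unit ideal. *)
Definition pos_invariant (f : {mpoly F[n]}) : Prop :=
  (exists2 d : nat, (0 < d)%N & f \is d.-homog) /\
  (forall g, g \in G -> to f g = f).

Definition hilbert_ideal : {pred {mpoly F[n]}} :=
  fun f => `[< ideal_gen pos_invariant f >].

Lemma hilbert_ideal_closed : idealr_closed hilbert_ideal.
Proof.
split.
- by apply/asboolP; exists 0%N, (fun=> 0), (fun=> 0); split=> [[]|] //;
    rewrite big_ord0.
- apply/negP => /asboolP [m [h [g [gP /(congr1 (mcoeff 0%MM))]]]].
  rewrite mcoeff1 eqxx raddf_sum big1 => [/eqP|j _]; first by rewrite oner_eq0.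
  have [[d d0 gd] _] := gP j.
  suff g0 : (g j)@_0%MM = 0 by rewrite /= rmorphM /= g0 mulr0.
  have d_neq : mdeg (0%MM : 'X_{1..n}) != d by rewrite mdeg0 eq_sym -lt0n.
  exact: (dhomog_nemf_coeff gd d_neq).
- move=> a u v /asboolP [m [h [g [gP ->]]]] /asboolP [k [h' [g' [g'P ->]]]].
  apply/asboolP; exists (m + k)%N.
  exists (fun j => match split j with inl i => a * h i | inr i => h' i end).
  exists (fun j => match split j with inl i => g i | inr i => g' i end).
  split=> [j|]; first by case: (split j).
  rewrite big_split_ord /= mulr_sumr; congr (_ + _); apply: eq_bigr => i _.
    by rewrite -[lshift _ _]/(unsplit (inl i)) unsplitK mulrA.
  by rewrite -[rshift _ _]/(unsplit (inr i)) unsplitK.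
Qed.

HB.instance Definition _ :=
  isIdealr.Build {mpoly F[n]} hilbert_ideal hilbert_ideal_closed.

Local Notation coinvariants := {ideal_quot hilbert_ideal}.

(* The degree d component is the image of the forms of degree d. *)
Definition coinv_homog (d : nat) (a : coinvariants) : Prop :=
  exists2 f : {mpoly F[n]}, f \is d.-homog &
    a = \pi_coinvariants f.

Definition coinv_nonzero_in_degree (d : nat) : Prop :=
  exists2 a : coinvariants, coinv_homog d a & a != 0.

Definition coinv_top_degree (d : nat) : Prop :=
  coinv_nonzero_in_degree d /\
  forall e, coinv_nonzero_in_degree e -> (e <= d)%N.

End GradedActions.

Section Variables_xyzw.

Variables (F : fieldType) (r s : nat).

Definition nvars : nat := ((r + r) + (s + s))%N.

Definition xvar (i : 'I_r) : {mpoly F[nvars]} := 'X_(lshift (s + s) (lshift r i)).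
Definition yvar (i : 'I_r) : {mpoly F[nvars]} := 'X_(lshift (s + s) (rshift r i)).
Definition zvar (i : 'I_s) : {mpoly F[nvars]} := 'X_(rshift (r + r) (lshift s i)).
Definition wvar (i : 'I_s) : {mpoly F[nvars]} := 'X_(rshift (r + r) (rshift s i)).

End Variables_xyzw.

Arguments xvar {F r} s i.
Arguments yvar {F r} s i.
Arguments zvar {F} r {s} i.
Arguments wvar {F} r {s} i.

(* MathComp actions are right actions: to f (g * h) = to (to f g) h. *)
Record dihedral_action (F : fieldType) (r s : nat) (gT : finGroupType)
    (G : {group gT}) (sigma rho : gT) (lambda : 'I_r -> F)
    (to : action G {mpoly F[nvars r s]}) : Prop := DihedralAction {
  da_graded : graded_alg_action to;
  da_sigma_x : forall i, to (xvar s i) sigma = yvar s i;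
  da_sigma_y : forall i, to (yvar s i) sigma = xvar s i;
  da_sigma_z : forall i, to (zvar r i) sigma = wvar r i;
  da_sigma_w : forall i, to (wvar r i) sigma = zvar r i;
  da_rho_x : forall i, to (xvar s i) rho = lambda i *: xvar s i;
  da_rho_y : forall i, to (yvar s i) rho = (lambda i)^-1 *: yvar s i;
  da_rho_z : forall i, to (zvar r i) rho = zvar r i;
  da_rho_w : forall i, to (wvar r i) rho = wvar r i
}.

(* Main.v *)
Require Import Defs.
From HB Require Import structures.
From mathcomp Require Import all_boot all_order all_algebra all_fingroup.
From mathcomp Require Import extremal zify.
From mathcomp Require Import boolp.
From mathcomp.multinomials Require Import mpoly.

(** The generators act on monomials: [sigma] permutes them by an involution
    [tau] of the variables, and [rho] scales each monomial [m] by its weight, a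
    p-th root of unity.  Hence the Hilbert ideal is generated by the products
    [x_i y_i] and [z_i w_i] and by the orbit sums [m + tau m] of the monomials
    [m] of weight 1, and everything becomes a question about which monomials lie
    in it.  Only the pairing [tau] and the weights matter, so the
    argument is run for [n] variables permuted without fixed points by [tau];
    the variables of nontrivial weight are the [x_i] and [y_i].

    Upper bound.  A monomial lies in the ideal if it contains both variables of
    a pair.  It also does if it factors as [m q], where [m] has weight 1 and
    shares a variable [v] with [q]: modulo the orbit sum of [m] it can be
    replaced by [(tau m) q], which contains the pair of [v]
    ([mono_mem_switch]).  So a monomial outside the ideal contains each pair of
    weight-1 variables at most once, and these contribute degree at most [s].
    If its remaining part had degree greater than [max(r, p)], some variable
    [v] of nontrivial weight would occur twice; the other factors of that part
    are at least [p - 1] in number, and the subproducts of [p - 1] nontrivial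
    p-th roots of unity take all p-th roots of unity as values, as in the
    Cauchy-Davenport theorem ([subweight_full]).  One of these subproducts has
    the inverse of the weight of [v], and together with [v] it is a factor [m]
    as above ([notin_nontrivial_part]).

    Lower bound.  Prescribe for each pair a degree [t], and let [detect] be the
    linear form adding up the coefficients of the monomials which contain
    exactly one variable of each pair, to the power [t].  If a weight-1 factor
    of such a monomial always takes up all or nothing of each pair, then
    applying [tau] to that factor permutes these monomials.  So [detect] sends a
    multiple of an invariant to a sum of equal terms in pairs, which is zero in
    characteristic two ([detect_hilbert]).  The degree [t = 1] on all pairs
    gives a nonzero class in degree [s + r], and [t = p] on one pair of
    nontrivial weight, [t = 0] on the others and [t = 1] on the pairs of weight
    1 gives one in degree [s + p]. *)

Set Implicit Arguments.
Unset Strict Implicit.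
Unset Printing Implicit Defensive.

Import Order.TTheory GRing.Theory.
Local Open Scope ring_scope.

(** * Preliminaries *)

(** The terms at [x] and [f x] cancel. The order serves to pick one element of
    each orbit of [f]. *)
Lemma sum_involution_char2 (R : nzRingType) (disp : Order.disp_t)
    (T : orderType disp) (l : seq T) (P : pred T) (f : T -> T) (c : T -> R) :
    2%N \in [pchar R] -> uniq l -> involutive f ->
    {in l, forall x, f x \in l} -> {in l, forall x, P x -> P (f x)} ->
    {in l, forall x, P x -> f x != x} -> {in l, forall x, c (f x) = c x} ->
  \sum_(x <- l | P x) c x = 0.
Proof.
move=> char2 ul fK fl Pf fN cf.
have Pf' : {in l, forall x, P (f x) = P x}.
  move=> x xl; apply/idP/idP => [|/Pf->//].
  by move/(Pf _ (fl _ xl)); rewrite fK.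
rewrite (bigID (fun x => (x < f x)%O)) /= [X in _ + X](_ : _ =
  \sum_(x <- l | P x && (x < f x)%O) c x).
  by rewrite (addrr_pchar2 char2).
have pl : perm_eq l (map f l).
  apply: uniq_perm => //; first by rewrite map_inj_uniq //; exact: inv_inj.
  move=> x; apply/idP/mapP => [xl|[y yl ->]]; last exact: fl.
  by exists (f x); rewrite ?fl ?fK.
rewrite (perm_big _ pl) big_map /= big_seq_cond [RHS]big_seq_cond.
apply: eq_big => [x|x /andP[xl _]]; last exact: cf.
case xl: (x \in l) => //=; rewrite Pf' // fK.
case Px: (P x) => //=.
by rewrite -leNgt le_eqVlt eq_sym (negPf (fN _ xl Px)).
Qed.

Lemma coinv_nonzeroP (F : fieldType) (n : nat) (gT : finGroupType)
    (G : {group gT}) (to : action G {mpoly F[n]}) (d : nat) :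
  coinv_nonzero_in_degree to d <->
  exists2 f : {mpoly F[n]}, f \is d.-homog & f \notin hilbert_ideal to.
Proof.
have pi0 f : (\pi_({ideal_quot (hilbert_ideal to)})%qT f != 0) =
    (f \notin hilbert_ideal to).
  congr (~~ _).
  by rewrite -[f in RHS]subr0 Quotient.idealrBE; congr (_ == _); rewrite piE.
split=> [[a [f fd ->]]|[f fd fI]]; first by rewrite pi0; exists f.
exists (\pi_({ideal_quot (hilbert_ideal to)})%qT f); last by rewrite pi0.
by exists f.
Qed.

(** * Monomials under the two generators *)

Section PairedVariables.

Variables (F : fieldType) (n : nat).
Variables (gT : finGroupType) (G : {group gT}) (sigma rho : gT).
Variable to : action G {mpoly F[n]}.
Variables (p : nat) (tau : 'S_n) (chi : 'I_n -> F).

Hypothesis p_prime : prime p.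
Hypothesis char2 : 2%N \in [pchar F].
Hypothesis to_graded : graded_alg_action to.
Hypothesis G_generated : <<[set sigma; rho]>>%g = G.
Hypothesis tauK : involutive tau.
Hypothesis tau_neq : forall i, tau i != i.
Hypothesis chi_tau : forall i, chi (tau i) = (chi i)^-1.
Hypothesis chi_root : forall i, chi i ^+ p = 1.
Hypothesis to_sigma : forall i, to 'X_i sigma = 'X_(tau i).
Hypothesis to_rho : forall i, to 'X_i rho = chi i *: 'X_i.

Local Notation I := (hilbert_ideal to).
Local Notation mon := 'X_{1..n}.
Local Notation "m # s" := [multinom m (s i) | i < n] (at level 40).

(** The eigenvalue of [rho] on the monomial [m]. *)
Definition weight (m : mon) : F := \prod_i chi i ^+ m i.

Definition nontrivial : {set 'I_n} := [set i | chi i != 1].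

Lemma weight0 : weight 0%MM = 1.
Proof. by rewrite /weight big1 // => i _; rewrite mnm0E expr0. Qed.

Lemma weightD m1 m2 : weight (m1 + m2)%MM = weight m1 * weight m2.
Proof.
by rewrite /weight -big_split; apply: eq_bigr => i _; rewrite mnmDE exprD.
Qed.

Lemma weight1 i : weight U_(i)%MM = chi i.
Proof.
rewrite /weight (bigD1 i) //= mnm1E eqxx expr1 big1 ?mulr1 // => j ji.
by rewrite mnm1E eq_sym (negPf ji) expr0.
Qed.

Lemma weight_tau (m : mon) : weight (m # tau) = (weight m)^-1.
Proof.
rewrite /weight -prodfV (reindex_inj (@perm_inj _ tau)).
by apply: eq_bigr => i _; rewrite mnmE tauK chi_tau exprVn.
Qed.

Lemma chi_neq0 i : chi i != 0.
Proof.
apply/eqP => c0; have /eqP := chi_root i.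
by rewrite c0 expr0n eqn0Ngt prime_gt0 // eq_sym oner_eq0.
Qed.

Lemma sigmaG : sigma \in G.
Proof. by rewrite -G_generated mem_gen // set21. Qed.

Lemma rhoG : rho \in G.
Proof. by rewrite -G_generated mem_gen // set22. Qed.

(** An algebra endomorphism is determined by the images of the variables. *)
Lemma lrmorphism_mpolyE (phi : {lrmorphism {mpoly F[n]} -> {mpoly F[n]}}) f :
  phi f = \sum_(m <- msupp f) f@_m *: \prod_i phi 'X_i ^+ m i.
Proof.
rewrite {1}[f]mpolyE linear_sum; apply: eq_bigr => m _.
rewrite linearZ mpolyXE_id rmorph_prod; congr (_ *: _).
by apply: eq_bigr => i _; rewrite rmorphXn.
Qed.

Lemma act_mpolyE g f : g \in G ->
  to f g = \sum_(m <- msupp f) f@_m *: \prod_i to 'X_i g ^+ m i.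
Proof.
move=> gG; pose phi := HB.pack_for {lrmorphism {mpoly F[n]} -> {mpoly F[n]}}
  (to^~ g)
  (GRing.isLinear.Build F _ _ _ (to^~ g) (gaa_linear to_graded gG))
  (GRing.isMonoidMorphism.Build _ _ (to^~ g)
     (gaa_monoid_morphism to_graded gG)).
exact: (lrmorphism_mpolyE phi).
Qed.

Lemma tauV : (tau^-1)%g = tau.
Proof. by apply/permP => i; apply: (@perm_inj _ tau); rewrite permKV tauK. Qed.

(** Identifying the action of [sigma] with [msym] gives access to the known
    coefficients and images of monomials. *)
Lemma act_sigmaE f : to f sigma = msym tau f.
Proof.
rewrite act_mpolyE ?sigmaG // [in RHS](mpolyE f) linear_sum /=.
apply: eq_bigr => m _; rewrite msymZ msymX tauV; congr (_ *: _).
rewrite (mpolyXE _ tau); apply: eq_bigr => i _.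
by rewrite to_sigma mnmE tauK.
Qed.

Lemma mcoeff_act_rho f m : (to f rho)@_m = weight m * f@_m.
Proof.
rewrite act_mpolyE ?rhoG // [in RHS](mpolyE f) !linear_sum mulr_sumr /=.
apply: eq_bigr => k _; rewrite !mcoeffZ mulrCA; congr (_ * _).
rewrite (eq_bigr (fun i => chi i ^+ k i *: 'X_i ^+ k i)); last first.
  by move=> i _; rewrite to_rho exprZn.
rewrite scaler_prod -mpolyXE_id mcoeffZ mcoeffX -/(weight k).
by case: eqP => [->//|_]; rewrite !mulr0.
Qed.

(** Comparing coefficients in [to g rho = g] leaves only the monomials of
    eigenvalue 1. *)
Lemma pos_invariant_weight g m :
  pos_invariant to g -> m \in msupp g -> weight m = 1.
Proof.
move=> [_ /(_ rho rhoG) gr]; rewrite mcoeff_msupp => gm.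
have := mcoeff_act_rho g m; rewrite gr => /esym/eqP.
rewrite -subr_eq0 -[X in _ - X]mul1r -mulrBl mulf_eq0 (negPf gm) orbF.
by rewrite subr_eq0 => /eqP.
Qed.

Lemma pos_invariant_tau g (m : mon) : pos_invariant to g -> g@_(m # tau) = g@_m.
Proof.
by move=> [_ /(_ sigma sigmaG)]; rewrite act_sigmaE -mcoeff_sym => ->.
Qed.

Lemma invariant_generators f :
  to f sigma = f -> to f rho = f -> forall g, g \in G -> to f g = f.
Proof.
move=> fs fr; have [to_inj toM] : is_action G to by case: to.
pose H := [set g in G | `[< to f g = f >]].
have gH : group_set H.
  apply/group_setP; split=> [|x y].
    rewrite inE group1; apply/asboolP.
    by apply: (to_inj 1%g); rewrite -toM ?group1 // mulg1.
  rewrite !inE => /andP[xG /asboolP fx] /andP[yG /asboolP fy].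
  by rewrite groupM //; apply/asboolP; rewrite toM // fx fy.
have sGH : G \subset Group gH.
  rewrite -{1}G_generated gen_subG; apply/subsetP => x; rewrite !inE.
  by case/orP=> /eqP->; rewrite ?sigmaG ?rhoG /=; apply/asboolP.
by move=> g /(subsetP sGH); rewrite inE => /andP[_ /asboolP].
Qed.

Lemma mem_pos_invariant f : pos_invariant to f -> f \in I.
Proof.
move=> fP; apply/asboolP; exists 1%N, (fun=> 1), (fun=> f).
by split=> //; rewrite big_ord1 mul1r.
Qed.

(** * Monomials in the Hilbert ideal *)

Lemma mem_orbit_sum (m : mon) : mdeg m != 0%N -> weight m = 1 ->
  'X_[m] + 'X_[m # tau] \in I.
Proof.
move=> m0 wm; apply: mem_pos_invariant; split.
  exists (mdeg m); first by rewrite lt0n.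
  by rewrite dhomogD // dhomogX /= ?mdeg_mperm.
have mK : (m # tau) # tau = m by apply/mnmP => i; rewrite !mnmE tauK.
apply: invariant_generators.
  by rewrite act_sigmaE linearD /= !msymX tauV mK addrC.
apply/mpolyP => k; rewrite mcoeff_act_rho mcoeffD !mcoeffX.
case: (m =P k) => [<-|_]; first by rewrite wm mul1r.
case: eqP => [<-|_]; first by rewrite weight_tau wm invr1 mul1r.
by rewrite !addr0 mulr0.
Qed.

Lemma mem_pair_product i : 'X_i * 'X_(tau i) \in I.
Proof.
apply: mem_pos_invariant; split.
  by exists 2%N => //; rewrite -mpolyXD dhomogX /= mdegD !mdeg1.
apply: invariant_generators.
  rewrite act_sigmaE msymM -!act_sigmaE !to_sigma tauK; exact: mulrC.
apply/mpolyP => k; rewrite mcoeff_act_rho -mpolyXD mcoeffX.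
case: eqP => [<-|_]; last by rewrite mulr0.
by rewrite weightD !weight1 chi_tau divff ?chi_neq0 // mul1r.
Qed.

Lemma mono_mem_pair (m : mon) i :
  m i != 0%N -> m (tau i) != 0%N -> 'X_[m] \in I.
Proof.
move=> mi mti; have le : (U_(i) + U_(tau i) <= m)%MM.
  apply/mnm_lepP => j; rewrite mnmDE !mnm1E.
  case: (i =P j) => [<-|_]; first by rewrite (negPf (tau_neq i)) lt0n.
  by case: (tau i =P j) => [<-|_] //; rewrite lt0n.
by rewrite -(submK le) !mpolyXD idealMr ?mem_pair_product.
Qed.

(** Modulo the orbit sum of [m], the factor [m] may be replaced by its mirror
    image, which turns its variable [i] into [tau i]; the variable [i] of [q]
    completes the pair. *)
Lemma mono_mem_switch (m q : mon) i :
  weight m = 1 -> m i != 0%N -> q i != 0%N -> 'X_[m + q] \in I.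
Proof.
move=> wm mi qi.
have m0 : mdeg m != 0%N.
  by rewrite mdeg_eq0; apply: contraNneq mi => ->; rewrite mnm0E.
have -> : 'X_[m + q] = 'X_[q] * ('X_[m] + 'X_[m # tau]) - 'X_[m # tau + q]
    :> {mpoly F[n]}.
  by rewrite !mpolyXD mulrDr [_ * 'X_[m]]mulrC [_ * 'X_[_ # _]]mulrC addrK.
rewrite rpredB ?idealMr ?mem_orbit_sum //.
apply: (@mono_mem_pair _ i); rewrite mnmDE ?mnmE ?tauK addn_eq0 negb_and.
  by rewrite qi orbT.
by rewrite mi.
Qed.

(** * Weights of submonomials *)

Lemma chi_prim i : i \in nontrivial -> p.-primitive_root (chi i).
Proof.
rewrite inE => c1.
have [k kP kp] := prim_order_exists (prime_gt0 p_prime) (chi_root i).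
have /primeP[_ /(_ k kp)] := p_prime.
case/orP=> /eqP kE; move: kP; rewrite kE //.
by move/prim_expr_order/eqP; rewrite expr1 (negPf c1).
Qed.

Definition subweight (q : mon) (c : F) : bool :=
  `[< exists2 q' : mon, (q' <= q)%MM & weight q' = c >].

(** Every further variable of nontrivial weight adds a new value, until all p-th
    roots of unity are reached. Otherwise the set of values, which contains 1,
    would be closed under multiplication by that weight, and a nontrivial p-th
    root of unity generates the group of all of them because p is prime. *)
Lemma subweight_count (zeta : F) (q : mon) : p.-primitive_root zeta ->
  (forall i, q i != 0%N -> i \in nontrivial) ->
  (minn p (mdeg q).+1 <=
   count (subweight q) [seq zeta ^+ j | j <- iota 0 p])%N.
Proof.
move=> zetaP; set mu := map _ _.
have mem_mu c : c ^+ p = 1 -> c \in mu.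
  move=> cp; have [j ->] := prim_rootP zetaP cp.
  by apply: map_f; rewrite mem_iota /= add0n.
have size_mu : size mu = p by rewrite size_map size_iota.
have sub1 q' : subweight q' 1.
  apply/asboolP; exists 0%MM; last exact: weight0.
  by apply/mnm_lepP => i; rewrite mnm0E.
have [d] := ubnP (mdeg q); elim: d q => // d IHd q dq qD.
have [->|q0] := eqVneq q 0%MM.
  rewrite mdeg0 (leq_trans (geq_minr _ _)) // -has_count.
  by apply/hasP; exists 1 => //; apply: mem_mu; rewrite expr1n.
have [i qi] : exists i, q i != 0%N.
  apply/existsP; apply: contraNT q0; rewrite negb_exists => /forallP q0.
  by apply/eqP/mnmP => i; rewrite mnm0E; apply/eqP; rewrite -[_ == _]negbK.
have le_iq : (U_(i) <= q)%MM by rewrite lep1mP.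
pose r := (q - U_(i))%MM; have qE : q = (r + U_(i))%MM by rewrite submK.
have dr : mdeg q = (mdeg r).+1 by rewrite qE mdegD mdeg1 addn1.
have rq : subpred (subweight r) (subweight q).
  move=> c /asboolP[r' ler' wr']; apply/asboolP; exists r' => //.
  by rewrite (lepm_trans ler') // qE lem_addr.
have {}IHd : (minn p (mdeg r).+1 <= count (subweight r) mu)%N.
  apply: IHd => [|j rj]; first by move: dq; rewrite dr ltnS.
  by apply: qD; rewrite qE mnmDE addn_eq0 negb_and rj.
have [allr|/allPn[c cmu ncr]] := boolP (all (subweight r) mu).
  move: allr; rewrite all_count size_mu => /eqP allr.
  by rewrite (leq_trans (geq_minl _ _)) // -{1}allr sub_count.
have zi := chi_prim (qD _ qi).
have cp : c ^+ p = 1.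
  by case/mapP: cmu => j _ ->; rewrite exprAC (prim_expr_order zetaP) expr1n.
have [k ck] := prim_rootP zi cp.
have exk : exists k, ~~ subweight r (chi i ^+ k) by exists k; rewrite -ck.
case: (ex_minnP exk) => -[|j] nj jmin; first by rewrite expr0 sub1 in nj.
have {jmin}rj : subweight r (chi i ^+ j).
  by apply: contraTT (ltnSn j) => /jmin; rewrite -leqNgt.
(* [b] is the first power of [chi i] which is not reached by [r]. *)
set b := chi i ^+ j.+1 in nj.
have qb : subweight q b.
  case/asboolP: rj => r' ler' wr'; apply/asboolP; exists (r' + U_(i))%MM.
    apply/mnm_lepP => l; rewrite qE !mnmDE leq_add2r; exact/mnm_lepP.
  by rewrite weightD weight1 wr' /b exprSr.
have bmu : b \in mu by apply: mem_mu; rewrite exprAC chi_root expr1n.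
have lt_count : (count (subweight r) mu < count (subweight q) mu)%N.
  have sub : subpred (predU (subweight r) (pred1 b)) (subweight q).
    by move=> x /orP[/rq//|/eqP->].
  apply: leq_trans (sub_count sub mu).
  have disj : count (predI (subweight r) (pred1 b)) mu = 0%N.
    apply/eqP; rewrite -leqn0 leqNgt -has_count; apply/hasPn => x _ /=.
    by apply/andP => -[xr /eqP xb]; rewrite -xb xr in nj.
  rewrite -[X in (_ < X)%N]addn0 -[X in (_ < _ + X)%N]disj.
  by rewrite count_predUI -addn1 leq_add2l -has_count has_pred1.
by move: IHd lt_count; rewrite dr; lia.
Qed.

Lemma subweight_full i (q : mon) : i \in nontrivial ->
  (forall j, q j != 0%N -> j \in nontrivial) -> (p.-1 <= mdeg q)%N ->
  exists2 q' : mon, (q' <= q)%MM & weight q' = (chi i)^-1.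
Proof.
move=> iD qD dq; have zi := chi_prim iD.
have := subweight_count zi qD.
have p0 := prime_gt0 p_prime.
have -> : minn p (mdeg q).+1 = p by move: dq p0; lia.
set mu := map _ _ => le_p.
have size_mu : size mu = p by rewrite size_map size_iota.
have /allP all_mu : all (subweight q) mu.
  by rewrite all_count eqn_leq count_size size_mu.
have /all_mu/asboolP : (chi i)^-1 \in mu; last by [].
have ci : ((chi i)^-1) ^+ p = 1 by rewrite exprVn chi_root invr1.
have [j ->] := prim_rootP zi ci.
by apply: map_f; rewrite mem_iota /= add0n.
Qed.

(** * Upper bound *)

(** Summing over the pairs through [m i + m (tau i)] counts each pair twice, but
    needs no choice of a representative in each pair. *)
Lemma sum_pairs (A : {set 'I_n}) (m : 'I_n -> nat) :
  (forall i, (tau i \in A) = (i \in A)) ->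
  ((\sum_(i in A) m i) * 2 = \sum_(i in A) (m i + m (tau i)))%N.
Proof.
move=> At; rewrite muln2 -addnn big_split /=; congr addn.
by rewrite (reindex_inj (@perm_inj _ tau)); apply: eq_bigl.
Qed.

Lemma leq_sum_pairs (A : {set 'I_n}) (m : mon) :
  (forall i, (tau i \in A) = (i \in A)) ->
  (forall i, i \in A -> m i + m (tau i) <= 1)%N ->
  (\sum_(i in A) m i <= #|A| %/ 2)%N.
Proof.
by move=> At mA; rewrite leq_divRL // sum_pairs // -sum1_card leq_sum.
Qed.

Lemma card_pairs (A : {set 'I_n}) :
  (forall i, (tau i \in A) = (i \in A)) -> (#|A| %/ 2 * 2)%N = #|A|.
Proof.
move=> At; have := sum_pairs (fun i => (i < tau i)%N : nat) At.
rewrite [RHS](eq_bigr (fun=> 1%N)) => [|i _].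
  by rewrite sum1_card => <-; rewrite mulnK.
have := tau_neq i; rewrite /= tauK -val_eqE /=; by case: ltngtP.
Qed.

Lemma nontrivial_tau i : (tau i \in nontrivial) = (i \in nontrivial).
Proof. by rewrite !inE chi_tau invr_eq1. Qed.

Lemma notin_pair (m : mon) i :
  'X_[m] \notin I -> (m i <= 1)%N -> (m (tau i) <= 1)%N ->
  (m i + m (tau i) <= 1)%N.
Proof.
move=> mI le1 le2.
case: (eqVneq (m i) 0%N) => [->//|mi].
case: (eqVneq (m (tau i)) 0%N) => [->|mj].
  by rewrite addn0.
by move: mI; rewrite (mono_mem_pair mi mj).
Qed.

(** A variable of weight 1 that occurs twice is by itself a factor of weight 1
    that can be switched. *)
Lemma notin_trivial_part (m : mon) : 'X_[m] \notin I ->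
  (\sum_(i in ~: nontrivial) m i <= #|~: nontrivial| %/ 2)%N.
Proof.
move=> mI.
have le1 i : i \in ~: nontrivial -> (m i <= 1)%N.
  rewrite !inE negbK => /eqP ci; rewrite leqNgt; apply: contra mI => mi.
  have le_im : (U_(i) <= m)%MM by rewrite lep1mP; move: mi; case: (m i).
  rewrite -(submK le_im) addmC (@mono_mem_switch _ _ i) //.
  - by rewrite weight1.
  - by rewrite mnm1E eqxx.
  - by rewrite mnmBE mnm1E eqxx subn_eq0 -ltnNge.
apply: leq_sum_pairs => i; first by rewrite !in_setC nontrivial_tau.
by move=> iD; rewrite notin_pair ?le1 // in_setC nontrivial_tau -in_setC.
Qed.

(** By the pigeonhole principle a variable [k] occurs twice. Without these two
    occurrences at least [p - 1] variables of nontrivial weight are left, enough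
    to complete one of the occurrences to a factor of weight 1. The other one is
    left outside this factor, which can therefore be switched. *)
Lemma notin_nontrivial_part (m : mon) : 'X_[m] \notin I ->
  (\sum_(i in nontrivial) m i <= maxn (#|nontrivial| %/ 2) p)%N.
Proof.
move=> mI; rewrite leqNgt gtn_max; apply/negP => /andP[gt_r gt_p].
have [k kD mk] : exists2 k, k \in nontrivial & (1 < m k)%N.
  apply/exists_inP; apply: contraLR gt_r; rewrite negb_exists_in -leqNgt.
  move/forall_inP => le1.
  apply: leq_sum_pairs => [i|i iD]; first exact: nontrivial_tau.
  by rewrite notin_pair // leqNgt le1 // nontrivial_tau.
pose mD : mon := [multinom (if i \in nontrivial then m i else 0%N) | i < n].
have dmD : mdeg mD = (\sum_(i in nontrivial) m i)%N.
  by rewrite mdegE [RHS]big_mkcond; apply: eq_bigr => i _; rewrite mnmE.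
have le2 : (U_(k) + U_(k) <= mD)%MM.
  apply/mnm_lepP => i; rewrite mnmDE mnm1E mnmE.
  by case: eqP => [<-|_] //; rewrite kD.
pose q := (mD - (U_(k) + U_(k)))%MM.
have qE : mD = (q + (U_(k) + U_(k)))%MM by rewrite submK.
have qD i : q i != 0%N -> i \in nontrivial.
  by rewrite mnmBE mnmE; case: ifP => // _; rewrite sub0n eqxx.
have dq : (p.-1 <= mdeg q)%N.
  move: gt_p (prime_gt0 p_prime); rewrite -dmD qE !mdegD mdeg1; lia.
have [q' leq' wq'] := subweight_full kD qD dq.
have lem : (q' + U_(k) + U_(k) <= m)%MM.
  apply/mnm_lepP => i; move/mnm_lepP/(_ i): leq' => leq'.
  have : (mD i <= m i)%N by rewrite mnmE; case: ifP.
  by apply: leq_trans; rewrite qE -addmA mnmDE [leqRHS]mnmDE leq_add2r.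
case/negP: mI; rewrite -(submK lem) addmC -addmA (@mono_mem_switch _ _ k) //.
- by rewrite weightD weight1 wq' mulVf ?chi_neq0.
- by rewrite mnmDE mnm1E eqxx addn1.
- by rewrite mnmDE mnm1E eqxx.
Qed.

Lemma homog_notin (f : {mpoly F[n]}) d : f \is d.-homog -> f \notin I ->
  exists2 m : mon, mdeg m = d & 'X_[m] \notin I.
Proof.
move=> /dhomogP fd fI; apply: contrapT => noM; case/negP: fI.
rewrite [f]mpolyE big_seq rpred_sum // => m mf.
rewrite -mul_mpolyC idealMr //; apply: contrapT => /negP mI.
by apply: noM; exists m => //; exact: fd.
Qed.

Lemma mdeg_split (m : mon) :
  (mdeg m = \sum_(i in ~: nontrivial) m i + \sum_(i in nontrivial) m i)%N.
Proof.
rewrite mdegE (bigID (mem nontrivial)) /= addnC; congr addn.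
by apply: eq_bigl => i; rewrite in_setC.
Qed.

Lemma nonzero_degree_le d : coinv_nonzero_in_degree to d ->
  (d <= #|~: nontrivial| %/ 2 +
        if nontrivial == set0 then 0 else maxn (#|nontrivial| %/ 2) p)%N.
Proof.
move=> /coinv_nonzeroP[f fd /(homog_notin fd)[m <- mI]].
rewrite mdeg_split leq_add ?notin_trivial_part //.
case: eqP => [->|_]; first by rewrite big_set0.
exact: notin_nontrivial_part.
Qed.

(** * Lower bound *)

Section LowerBound.

Variable t : 'I_n -> nat.
Hypothesis t_tau : forall i, t (tau i) = t i.
(** A monomial of weight 1 that divides a target monomial (defined below) takes
    up all or nothing of each pair. *)
Hypothesis t_rigid : forall m : mon, weight m = 1 ->
  (forall i, m i + m (tau i) <= t i)%N ->
  (forall i, m i * m (tau i) = 0)%N ->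
  forall i, ((m i + m (tau i) == 0) || (m i + m (tau i) == t i))%N.

(** Together the two conditions say that the exponents of [i] and [tau i] are
    [t i] and 0 in one of the two orders. *)
Definition target (m : mon) : bool :=
  [forall i, (m i + m (tau i) == t i)%N && (m i * m (tau i) == 0)%N].

Lemma targetP (m : mon) :
  reflect (forall i, (m i + m (tau i) = t i)%N /\ (m i * m (tau i) = 0)%N)
    (target m).
Proof.
apply: (iffP forallP) => mP i; have := mP i.
  by case/andP=> /eqP-> /eqP->.
by case=> -> ->; rewrite !eqxx.
Qed.

Lemma mdeg_double (m : mon) : (mdeg m * 2 = \sum_i (m i + m (tau i)))%N.
Proof.
have T i : (tau i \in [set: 'I_n]) = (i \in [set: 'I_n]) by rewrite !in_setT.
have := sum_pairs m T; under eq_bigl do rewrite in_setT; rewrite -mdegE => ->.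
by apply: eq_bigl => i; rewrite in_setT.
Qed.

Lemma target_mdeg (m : mon) : target m -> (mdeg m * 2 = \sum_i t i)%N.
Proof.
by move/targetP=> mP; rewrite mdeg_double; apply: eq_bigr => i _; case: (mP i).
Qed.

(** All target monomials have degree half the sum of [t], so the bound on the
    degree excludes none of them; it only makes the index set finite. *)
Definition detect (f : {mpoly F[n]}) : F :=
  \sum_(m : 'X_{1..n < (\sum_i t i).+1} | target m) f@_m.

Fact detect_is_linear : linear_for *%R detect.
Proof.
move=> a f g; rewrite /detect mulr_sumr -big_split.
by apply: eq_bigr => m _; rewrite mcoeffD mcoeffZ.
Qed.

HB.instance Definition _ :=
  GRing.isLinear.Build F {mpoly F[n]} F *%R detect detect_is_linear.

Lemma detectX (m : mon) : detect 'X_[m] = (target m)%:R.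
Proof.
rewrite /detect.
have [mT|mT] := boolP (target m); last first.
  rewrite big1 // => k kT; rewrite mcoeffX; case: eqP => // mk.
  by rewrite mk kT in mT.
have dm : (mdeg m < (\sum_i t i).+1)%N by rewrite ltnS -(target_mdeg mT); lia.
rewrite (bigD1 (BMultinom dm)) //= mcoeffX eqxx big1 ?addr0 // => k /andP[_ km].
by rewrite mcoeffX; case: eqP => // mk; case/eqP: km; apply/val_inj.
Qed.

(** Where [k] misses a pair nothing changes; where it takes up a whole pair, [q]
    misses it and the two exponents are exchanged. *)
Lemma target_tau g (q k : mon) : pos_invariant to g -> k \in msupp g ->
  target (q + k)%MM -> target (q + (k # tau))%MM.
Proof.
move=> gP kg /targetP qk; apply/targetP => i.
have wk := pos_invariant_weight gP kg.
have kle j : (k j + k (tau j) <= t j)%N.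
  by case: (qk j) => <- _; rewrite !mnmDE; lia.
have kdisj j : (k j * k (tau j) = 0)%N.
  case: (qk j) => _ /eqP; rewrite !mnmDE muln_eq0 !addn_eq0 => H.
  by apply/eqP; rewrite muln_eq0; lia.
have := t_rigid wk kle kdisj i; case: (qk i); rewrite !mnmDE !mnmE tauK.
set a := q i; set b := q _; set c := k i; set d := k _.
move=> <- /eqP; rewrite muln_eq0 !addn_eq0 => H1 H2; split; first by lia.
apply/eqP; rewrite muln_eq0 !addn_eq0; lia.
Qed.

(** A monomial fixed by [tau] and different from 1 contains both variables of a
    pair, which no target monomial does. *)
Lemma target_tau_neq g (q k : mon) : pos_invariant to g -> k \in msupp g ->
  target (q + k)%MM -> k # tau != k.
Proof.
move=> [[d d0 /dhomogP gd] _] /gd /= dk /targetP qk; apply/eqP => ktau.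
suff k0 : k = 0%MM by rewrite -dk k0 mdeg0 in d0.
apply/mnmP => i; rewrite mnm0E.
have kt : k (tau i) = k i by rewrite -{2}ktau mnmE.
by case: (qk i) => _ /eqP; rewrite !mnmDE kt muln_eq0 !addn_eq0; lia.
Qed.

(** By linearity the multiplier of an invariant [g] may be a monomial [q]. The
    monomials [k] of [g] for which [q k] is a target are permuted by [tau]
    without fixed points, and [g] has equal coefficients at [k] and [tau k]. *)
Lemma detect_hilbert f : f \in I -> detect f = 0.
Proof.
move=> /asboolP[l [h [g [gP ->]]]]; rewrite linear_sum big1 // => j _.
move: (h j) (g j) (gP j) => {h g gP l j}h g gP.
rewrite [h]mpolyE mulr_suml linear_sum big1 // => q _.
rewrite -scalerAl linearZ; apply/eqP; rewrite mulf_eq0; apply/orP; right.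
rewrite {1}[g]mpolyE mulr_sumr linear_sum; apply/eqP.
rewrite (eq_bigr (fun k => if target (q + k)%MM then g@_k else 0)); last first.
  move=> k _; rewrite -scalerAr linearZ -mpolyXD /= detectX.
  by case: ifP; rewrite ?mulr1 ?mulr0.
rewrite -big_mkcond.
rewrite (@sum_involution_char2 _ _ _ _ _ (fun k : mon => k # tau)) //.
- exact: msupp_uniq.
- by move=> k; apply/mnmP => i; rewrite !mnmE tauK.
- by move=> k; rewrite !mcoeff_msupp pos_invariant_tau.
- by move=> k kg; exact: (target_tau gP).
- by move=> k kg; exact: (target_tau_neq gP).
- by move=> k _; exact: pos_invariant_tau.
Qed.

Lemma nonzero_degree_rigid :
  exists2 d, coinv_nonzero_in_degree to d & (d * 2 = \sum_i t i)%N.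
Proof.
(* The order of the indices selects one variable in each pair. *)
pose m : mon := [multinom (if (i < tau i)%N then t i else 0%N) | i < n].
have mT : target m.
  apply/targetP => i; rewrite !mnmE tauK t_tau.
  have := tau_neq i; rewrite -val_eqE /=; case: ltngtP => // _ _.
  by rewrite muln0 addn0.
exists (mdeg m); last exact: target_mdeg.
apply/coinv_nonzeroP; exists 'X_[m]; first by rewrite dhomogX.
by apply/negP => /detect_hilbert/eqP; rewrite detectX mT oner_eq0.
Qed.

End LowerBound.

(** With [t = 1] every pair is taken up completely or not at all, whatever the
    weights are. *)
Lemma nonzero_half_number_of_variables :
  coinv_nonzero_in_degree to
    (#|~: nontrivial| %/ 2 + #|nontrivial| %/ 2)%N.
Proof.
have [||d dP dE] := @nonzero_degree_rigid (fun=> 1%N) => //.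
  by move=> m _ le1 _ i; have := le1 i; lia.
have E1 := card_pairs nontrivial_tau.
have E2 : (#|~: nontrivial| %/ 2 * 2)%N = #|~: nontrivial|.
  by apply: card_pairs => i; rewrite !in_setC nontrivial_tau.
have := cardsC nontrivial; move: dE; rewrite sum1_card !card_ord => dE E3.
by rewrite (_ : (_ + _)%N = d) //; lia.
Qed.

(** A monomial dividing a target contains a single power of [k] or of [tau k] of
    exponent at most [p], besides variables of weight 1. Since [chi k] has order
    [p], weight 1 forces the exponent to be 0 or [p]. *)
Lemma nonzero_prime_degree k : k \in nontrivial ->
  coinv_nonzero_in_degree to (#|~: nontrivial| %/ 2 + p)%N.
Proof.
move=> kD.
pose t i := if i \in nontrivial then
  if (i == k) || (i == tau k) then p else 0%N else 1%N.
have tauE i : (tau i == k) || (tau i == tau k) = (i == k) || (i == tau k).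
  rewrite (inj_eq (@perm_inj _ tau)) orbC; congr orb.
  by apply/eqP/eqP => [<-|->]; rewrite tauK.
have [i|m wm mle m0 i|d dP dE] := @nonzero_degree_rigid t.
- by rewrite /t nontrivial_tau tauE.
- have := mle i; rewrite /t; case: ifP => [iD|_]; last by lia.
  case: ifP => [ik _|_]; last by lia.
  have {wm} : chi k ^+ m k * chi (tau k) ^+ m (tau k) = 1.
    rewrite -wm /weight (bigD1 k) //= (bigD1 (tau k)) //=.
    rewrite big1 ?mulr1 // => j /andP[jk jtk].
    have := mle j; rewrite /t (negPf jk) (negPf jtk) /=.
    case: ifP => [_|]; last by rewrite inE => /negbFE/eqP-> _; rewrite expr1n.
    by rewrite leqn0 addn_eq0 => /andP[/eqP-> _].
  have := mle k; have := m0 k; rewrite /t kD eqxx /= => /eqP.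
  rewrite muln_eq0 => mk_or lep.
  have -> : (m i + m (tau i) = m k + m (tau k))%N.
    by case/orP: ik => /eqP->; rewrite ?tauK // addnC.
  have tkD : tau k \in nontrivial by rewrite nontrivial_tau.
  have dvd a : (a <= p)%N -> (p %| a)%N -> (a == 0%N) || (a == p).
    case: a => // a le_ap /(dvdn_leq (ltn0Sn _)) ge_ap.
    by apply/orP; right; lia.
  case/orP: mk_or => /eqP m_0; rewrite m_0 expr0 ?mul1r ?mulr1 => /eqP.
    by rewrite -(prim_order_dvd (chi_prim tkD)) => /dvd; apply; lia.
  by rewrite -(prim_order_dvd (chi_prim kD)) addn0 => /dvd; apply; lia.
have E2 : (#|~: nontrivial| %/ 2 * 2)%N = #|~: nontrivial|.
  by apply: card_pairs => i; rewrite !in_setC nontrivial_tau.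
have sum_t : (\sum_i t i = #|~: nontrivial| + p * 2)%N.
  rewrite (bigID (mem nontrivial)) /= addnC; congr addn.
    rewrite -sum1_card; apply: eq_big => i; first by rewrite in_setC.
    by rewrite /t => /negPf->.
  rewrite (bigD1 k) //= (bigD1 (tau k)) /=; last first.
    by rewrite nontrivial_tau kD tau_neq.
  rewrite big1 => [|i /andP[/andP[iD ik] itk]].
    by rewrite /t nontrivial_tau kD !eqxx orbT /=; lia.
  by rewrite /t iD (negPf ik) (negPf itk).
by move: dE; rewrite sum_t => dE; rewrite (_ : (_ + _)%N = d) //; lia.
Qed.

(** If all weights are 1, no monomial outside the ideal contains a variable
    twice, so the number of pairs alone bounds the degree; hence the case
    distinction. *)
Theorem paired_top_degree :
  coinv_top_degree to (#|~: nontrivial| %/ 2 +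
    if nontrivial == set0 then 0 else maxn (#|nontrivial| %/ 2) p)%N.
Proof.
split; last exact: nonzero_degree_le.
have half := nonzero_half_number_of_variables.
case: (set_0Vmem nontrivial) => [D0|[k kD]].
  by move: half; rewrite D0 eqxx cards0.
have -> : (nontrivial == set0) = false.
  by apply/negbTE/set0Pn; exists k.
by case: (leqP p) => _ //; exact: nonzero_prime_degree kD.
Qed.

End PairedVariables.

(** * The variables of the dihedral action *)

Section DihedralVariables.

Variables (F : fieldType) (r s : nat) (lambda : 'I_r -> F).

Definition swap_halves n (i : 'I_(n + n)) : 'I_(n + n) :=
  match split i with inl j => rshift n j | inr j => lshift n j end.

Definition swap_vars (i : 'I_(nvars r s)) : 'I_(nvars r s) :=
  match split i with
  | inl j => lshift (s + s) (swap_halves j)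
  | inr j => rshift (r + r) (swap_halves j)
  end.

Definition rho_eigenvalue (i : 'I_(nvars r s)) : F :=
  match split i with
  | inl j => match split j with inl a => lambda a | inr a => (lambda a)^-1 end
  | inr _ => 1
  end.

Lemma split_lshift m n (i : 'I_m) : split (lshift n i) = inl i.
Proof. exact: (unsplitK (inl i)). Qed.

Lemma split_rshift m n (i : 'I_n) : split (rshift m i) = inr i.
Proof. exact: (unsplitK (inr i)). Qed.

Lemma swap_halvesK n : involutive (@swap_halves n).
Proof.
move=> i; rewrite /swap_halves.
by case: (split_ordP i) => j ->; rewrite ?split_lshift ?split_rshift.
Qed.

Lemma swap_halves_neq n (i : 'I_(n + n)) : swap_halves i != i.
Proof.
rewrite /swap_halves; case: (split_ordP i) => j ->.
  by rewrite eq_rlshift.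
by rewrite eq_lrshift.
Qed.

Lemma swap_varsK : involutive swap_vars.
Proof.
move=> i; rewrite /swap_vars.
by case: (split_ordP i) => j ->;
  rewrite ?(split_lshift, split_rshift) swap_halvesK.
Qed.

Lemma swap_vars_neq i : swap_vars i != i.
Proof.
rewrite /swap_vars; case: (split_ordP i) => j ->.
  by rewrite eq_lshift swap_halves_neq.
by rewrite eq_rshift swap_halves_neq.
Qed.

Lemma rho_eigenvalue_swap i :
  rho_eigenvalue (swap_vars i) = (rho_eigenvalue i)^-1.
Proof.
rewrite /rho_eigenvalue /swap_vars /swap_halves.
case: (split_ordP i) => j _; rewrite ?(split_lshift, split_rshift) ?invr1 //.
by case: (split_ordP j) => a _; rewrite !(split_lshift, split_rshift) ?invrK.
Qed.

Lemma rho_eigenvalue_root p i :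
  (forall a, lambda a ^+ p = 1) -> rho_eigenvalue i ^+ p = 1.
Proof.
move=> lp; rewrite /rho_eigenvalue.
case: (split i) => [j|_]; last exact: expr1n.
by case: (split j) => a; rewrite ?exprVn lp ?invr1.
Qed.

Lemma nontrivial_rho_eigenvalue : (forall a, lambda a != 1) ->
  nontrivial rho_eigenvalue = [set lshift (s + s) j | j : 'I_(r + r)].
Proof.
move=> l1; apply/setP => i; rewrite inE /rho_eigenvalue.
case: (split_ordP i) => j ->; rewrite ?(split_lshift, split_rshift).
  rewrite imset_f //; case: (split j) => a; rewrite ?invr_eq1; exact: l1.
rewrite eqxx; apply/esym/negbTE/imsetP => -[k _ /eqP].
by rewrite eq_rlshift.
Qed.

End DihedralVariables.

(** * Top degree of the coinvariants *)

Theorem theorem8 (p : nat) (p_prime : prime p) (p_odd : odd p)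
    (F : fieldType) (char2 : 2%N \in [pchar F])
    (has_root : exists zeta : F, p.-primitive_root zeta)
    (gT : finGroupType) (G : {group gT}) (sigma rho : gT)
    (G_dihedral : (G \isog 'D_(2 * p))%g)
    (sigma_order : #[sigma]%g = 2%N) (rho_order : #[rho]%g = p)
    (G_generated : <<[set sigma; rho]>>%g = G)
    (r s : nat) (lambda : 'I_r -> F)
    (lambda_root : forall i, lambda i ^+ p = 1)
    (lambda_nontrivial : forall i, lambda i != 1)
    (to : action G {mpoly F[nvars r s]})
    (to_dihedral : dihedral_action sigma rho lambda to) :
  ((1 <= r)%N -> coinv_top_degree to (s + maxn r p)) /\
  (r = 0%N -> coinv_top_degree to s).
Proof.
case: to_dihedral => graded sx sy sz sw rx ry rz rw.
pose tau := perm (can_inj (@swap_varsK r s)).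
pose chi : 'I_(nvars r s) -> F := rho_eigenvalue lambda.
have tauE : tau =1 @swap_vars r s by move=> i; rewrite permE.
have to_sigma i : to 'X_i sigma = 'X_(tau i).
  rewrite tauE /swap_vars /swap_halves.
  case: (split_ordP i) => j ->; case: (split_ordP j) => a ->.
  - by rewrite -/(xvar s a) sx.
  - by rewrite -/(yvar s a) sy.
  - by rewrite -/(zvar r a) sz.
  - by rewrite -/(wvar r a) sw.
have to_rho i : to 'X_i rho = chi i *: 'X_i.
  rewrite /chi /rho_eigenvalue.
  case: (split_ordP i) => j ->.
    case: (split_ordP j) => a ->; [exact: rx | exact: ry].
  by rewrite scale1r; case: (split_ordP j) => a ->; [exact: rz | exact: rw].
have := @paired_top_degree F _ gT G sigma rho to p tau chi p_prime char2 graded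
  G_generated.
rewrite nontrivial_rho_eigenvalue //.
set D := [set _ | _ in _].
have cardD : #|D| = (r + r)%N.
  by rewrite card_imset ?card_ord //; exact: lshift_inj.
have -> : (#|~: D| %/ 2 = s)%N.
  by have := cardsC D; rewrite cardD card_ord /nvars; lia.
have -> : (D == set0) = (r == 0%N) by rewrite -cards_eq0 cardD addn_eq0 andbb.
have -> : (#|D| %/ 2 = r)%N by rewrite cardD; lia.
move=> top; have {}top : coinv_top_degree to
    (s + if r == 0%N then 0%N else maxn r p).
  apply: top => // i.
  - by rewrite !tauE swap_varsK.
  - by rewrite tauE swap_vars_neq.
  - by rewrite tauE /chi rho_eigenvalue_swap.
  - exact: rho_eigenvalue_root.
split=> [r_gt0|r0]; first by rewrite eqn0Ngt r_gt0 in top.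
by move: top; case: eqP => // _; rewrite addn0.
Qed.
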